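(* Let $n\ge 3$, $\beta\in\mathbb{C}$, and let $\widetilde L$ be a one-dimensional non-split extension of the solvable Lie algebra $\mathfrak{s}^1_{n,1}(\beta)$. Then $\widetilde L$ is isomorphic to one of the following algebras: $$\mathfrak{s}^1_{n+1,1}(\beta),\qquad \tau^1_{n+1,1}(\beta),\qquad \tau^2_{n+1,1}$$ (the algebras $\tau^1_{n+1,1}(\beta)$ and $\tau^2_{n+1,1}$ being defined only for $n$ odd), and $\widetilde{L_k}$ with $2\le k\le\lfloor n/2\rfloor$, where $\widetilde{L_k}$ has basis $x,e_1,\dots,e_{n+1}$ and products $$[e_i,e_1]=e_{i+1}\ (2\le i\le n),\quad [e_i,e_{2k+1-i}]=(-1)^ie_{n+1}\ (2\le i\le k),\quad [e_1,x]=e_1,\quad [e_i,x]=(n+i-2k)e_i\ (2\le i\le n+1).$$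
   Context: All algebras are finite-dimensional over $\mathbb{C}$; brackets are antisymmetric and unlisted brackets of basis vectors are zero. $\mathfrak{s}^1_{n,1}(\beta)$: basis $x,e_1,\dots,e_n$; $[e_i,e_1]=e_{i+1}$ ($2\le i\le n-1$), $[e_1,x]=e_1$, $[e_i,x]=(i-2+\beta)e_i$ ($2\le i\le n$). Its nilradical is taken to be $N=n_{n,1}=\langle e_1,\dots,e_n\rangle$. $\tau^1_{2m,1}(\alpha)$: basis $x,e_1,\dots,e_{2m}$; $[e_i,e_1]=e_{i+1}$ ($2\le i\le 2m-2$), $[e_i,e_{2m+1-i}]=(-1)^ie_{2m}$ ($2\le i\le m$), $[e_1,x]=e_1$, $[e_i,x]=(i-2+\alpha)e_i$ ($2\le i\le 2m-1$), $[e_{2m},x]=(2m-3+2\alpha)e_{2m}$. $\tau^2_{2m,1}$: basis $x,e_1,\dots,e_{2m}$; $[e_i,e_1]=e_{i+1}$ ($2\le i\le 2m-2$), $[e_i,e_{2m+1-i}]=(-1)^ie_{2m}$ ($2\le i\le m$), $[e_1,x]=e_1+e_{2m}$, $[e_i,x]=(i-m)e_i$ ($2\le i\le 2m-1$), $[e_{2m},x]=e_{2m}$. Extensions: let $L$ be a solvable Lie algebra with nilradical $N$, $\mathbb V$ a vector space, $\theta:L\to\operatorname{End}\mathbb V$ a representation, and $\psi:L\times L\to\mathbb V$ an antisymmetric bilinear map with $$\psi(x,[y,z])+\psi(z,[x,y])+\psi(y,[z,x])+\theta(x)\psi(y,z)+\theta(z)\psi(x,y)+\theta(y)\psi(z,x)=0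 .$$ The extension $L(\psi,\theta)$ of $L$ by $\mathbb V$ is $L\oplus\mathbb V$ with bracket $[x+u,y+v]=[x,y]+\psi(x,y)+\theta(x)v-\theta(y)u$. Only extensions whose nilradical is a central extension of $N$ by $\mathbb V$ are considered, equivalently $N\subseteq\operatorname{Ker}\theta$. The extension is one-dimensional if $\dim\mathbb V=1$. Put $\psi^0=\psi|_{N\times N}$ and $\operatorname{Ann}(\psi^0)=\{x\in N:\psi^0(x,N)=0\}$; a one-dimensional extension is non-split if $\operatorname{Ann}(\psi^0)\cap Z(N)=0$, where $Z(N)$ is the center of $N$. *)

(* Defs.v *)
From HB Require Import structures.
From mathcomp Require Import all_boot all_order all_algebra.
From mathcomp Require Import zify ring.
Set Implicit Arguments.
Unset Strict Implicit.
Unset Printing Implicit Defensive.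
Import Order.TTheory GRing.Theory Num.Theory.
Local Open Scope ring_scope.

Record lieAlgebra (K : numFieldType) := LieAlgebra {
  lie_sort :> vectType K;
  lie_bracket : {bilinear lie_sort -> lie_sort -> lie_sort};
  lie_anti : forall x y, lie_bracket x y = - lie_bracket y x;
  lie_jacobi : forall x y z,
    lie_bracket x (lie_bracket y z) + lie_bracket y (lie_bracket z x)
      + lie_bracket z (lie_bracket x y) = 0
}.

Notation "[ 'lie' x , y ]" := (lie_bracket _ x y)
  (at level 0, x at level 99, y at level 99, format "[ 'lie'  x ,  y ]") : ring_scope.

Definition lie_isomorphic (K : numFieldType) (L M : lieAlgebra K) : Prop :=
  exists f : {linear L -> M},
    bijective f /\ forall x y : L, f [lie x, y] = [lie f x, f y].

Section Extension.
Variables (K : numFieldType) (L : lieAlgebra K) (N : {vspace L}) (V : vectType K).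

(* N plays the role of the nilradical of L; the last field says that the
   nilradical of the extension is a central extension of N by V. *)
Record extension := Extension {
  ext_theta : {linear L -> 'End(V)};
  ext_psi : {bilinear L -> L -> V};
  ext_theta_rep : forall x y v,
    ext_theta [lie x, y] v
      = ext_theta x (ext_theta y v) - ext_theta y (ext_theta x v);
  ext_psi_anti : forall x y, ext_psi x y = - ext_psi y x;
  ext_psi_cocycle : forall x y z,
    ext_psi x [lie y, z] + ext_psi z [lie x, y] + ext_psi y [lie z, x]
      + ext_theta x (ext_psi y z) + ext_theta z (ext_psi x y)
      + ext_theta y (ext_psi z x) = 0;
  ext_theta_nilradical : forall x, x \in N -> ext_theta x = 0
}.

Variable E : extension.

Definition ext_bracket (p q : (L * V)%type) : (L * V)%type :=
  ([lie p.1, q.1],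
   ext_psi E p.1 q.1 + ext_theta E p.1 q.2 - ext_theta E q.1 p.2).

Lemma ext_bracket_bilinear : bilinear_for *:%R *:%R ext_bracket.
Proof.
have combine a (A A' B B' C C' : V) :
  (a *: A + A') + (a *: B + B') + (a *: C + C')
    = a *: (A + B + C) + (A' + B' + C').
  by rewrite !scalerDr (addrACA (a *: A)) [LHS]addrACA.
split=> [q|p] a r r'; congr pair => /=.
- by rewrite linearPl.
- by rewrite linearPl !linearP /= add_lfunE scale_lfunE combine.
- by rewrite linearPr.
- by rewrite linearPr !linearP /= add_lfunE scale_lfunE opprD -scalerN combine.
Qed.

HB.instance Definition _ :=
  bilinear_isBilinear.Build K (L * V)%type (L * V)%type (L * V)%type *:%R *:%R
    ext_bracket ext_bracket_bilinear.

Lemma ext_bracket_anti p q : ext_bracket p q = - ext_bracket q p.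
Proof.
congr pair => /=; first exact: lie_anti.
rewrite [ext_psi E p.1 q.1]ext_psi_anti /=.
by rewrite !opprD opprK addrAC.
Qed.

Let ext_jacobi_sum (P Q S A B C b1 b2 b3 b4 b5 b6 : V) :
  P + (A + b1 - b2) + (- b3 - - b4) + (Q + (B + b3 - b5) + (- b6 - - b2))
    + (S + (C + b6 - b4) + (- b1 - - b5)) = P + S + Q + A + C + B.
Proof.
rewrite [LHS](coord_vbasis (memvf _)) [RHS](coord_vbasis (memvf _)).
apply: eq_bigr => i _; congr (_ *: _).
by rewrite !(raddfD, raddfN) /=; ring.
Qed.

Lemma ext_bracket_jacobi p q r :
  ext_bracket p (ext_bracket q r) + ext_bracket q (ext_bracket r p)
    + ext_bracket r (ext_bracket p q) = 0.
Proof.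
case: p q r => [x u] [y v] [z w]; congr pair => /=; first exact: lie_jacobi.
rewrite !ext_theta_rep !linearB !linearD /=.
exact: etrans (ext_jacobi_sum _ _ _ _ _ _ _ _ _ _ _ _) (ext_psi_cocycle E x y z).
Qed.

Definition ext_lie : lieAlgebra K :=
  LieAlgebra ext_bracket_anti ext_bracket_jacobi.

(* Z(N), the center of N itself, not of L. *)
Definition in_center (x : L) : Prop :=
  x \in N /\ forall y, y \in N -> [lie x, y] = 0.

Definition in_ann (x : L) : Prop :=
  x \in N /\ forall y, y \in N -> ext_psi E x y = 0.

Definition ext_nonsplit : Prop := forall x, in_ann x -> in_center x -> x = 0.

End Extension.

Section Tables.
Variable K : numFieldType.

(* Basis of the algebras below: index 0 is x and index i > 0 is e_i. An index
   i > n gives the zero vector. *)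
Definition basis_vec (n i : nat) : 'rV[K]_n.+1 := \row_(j < n.+1) (j == i :> nat)%:R.

Section Bracket.
Variables (n : nat) (tab : nat -> nat -> 'rV[K]_n.+1).

(* tab i j is the listed product of the basis vectors i and j, 0 if unlisted.
   Each tabulated product is listed in one order only, so antisymmetrizing the
   table gives the bracket. *)
Definition tab_bracket (u v : 'rV[K]_n.+1) : 'rV[K]_n.+1 :=
  \sum_(i < n.+1) \sum_(j < n.+1) (u 0 i * v 0 j) *: (tab i j - tab j i).

Lemma tab_bracket_anti u v : tab_bracket u v = - tab_bracket v u.
Proof.
rewrite /tab_bracket exchange_big /= -sumrN; apply: eq_bigr => i _.
rewrite -sumrN; apply: eq_bigr => j _.
by rewrite -scalerN opprB mulrC.
Qed.

Lemma tab_bracket_bilinear : bilinear_for *:%R *:%R tab_bracket.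
Proof.
have lin v : linear (tab_bracket^~ v).
  move=> a u u'; rewrite /tab_bracket scaler_sumr -big_split /=.
  apply: eq_bigr => i _; rewrite scaler_sumr -big_split /=.
  by apply: eq_bigr => j _; rewrite !mxE scalerA -scalerDl mulrDl mulrA.
split=> [v|u] a r r'; first exact: lin.
by rewrite tab_bracket_anti lin opprD -scalerN -!tab_bracket_anti.
Qed.

HB.instance Definition _ :=
  bilinear_isBilinear.Build K 'rV[K]_n.+1 'rV[K]_n.+1 'rV[K]_n.+1 *:%R *:%R
    tab_bracket tab_bracket_bilinear.

Lemma tab_bracketE (i j : nat) : (i <= n)%N -> (j <= n)%N ->
  tab_bracket (basis_vec n i) (basis_vec n j) = tab i j - tab j i.
Proof.
move=> lin ljn; rewrite /tab_bracket.
rewrite (bigD1 (Ordinal (lin : (i < n.+1)%N))) //= [X in _ + X]big1 => [|i' /negPf ni'].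
  rewrite addr0 (bigD1 (Ordinal (ljn : (j < n.+1)%N))) //= [X in _ + X]big1 => [|j' /negPf nj'].
    by rewrite !mxE !eqxx mulr1 scale1r addr0.
  by rewrite !mxE -val_eqE /= in nj' *; rewrite nj' mulr0 scale0r.
by rewrite big1 // => j' _; rewrite !mxE -val_eqE /= in ni' *; rewrite ni' mul0r scale0r.
Qed.

Lemma row_basis (u : 'rV[K]_n.+1) : u = \sum_(i < n.+1) u 0 i *: basis_vec n i.
Proof.
apply/rowP => j; rewrite summxE (bigD1 j) //= big1 => [|i ij].
  by rewrite !mxE eqxx mulr1 addr0.
by rewrite !mxE eq_sym (inj_eq val_inj) (negPf ij) mulr0.
Qed.

Local Notation J u v w := (tab_bracket u (tab_bracket v w)
  + tab_bracket v (tab_bracket w u) + tab_bracket w (tab_bracket u v)).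

Lemma tab_jacobi :
  (forall i j l, (i < j < l)%N -> (l <= n)%N ->
     J (basis_vec n i) (basis_vec n j) (basis_vec n l) = 0) ->
  forall u v w, J u v w = 0.
Proof.
move=> H.
have Jcyc u v w : J u v w = J v w u by rewrite -addrA addrC.
have Janti u v w : J u v w = - J u w v.
  rewrite (tab_bracket_anti v w) (tab_bracket_anti w u) (tab_bracket_anti u v).
  by rewrite !linearNr /= !opprD -!addrA; congr (_ + _); rewrite addrC.
have Jlin v w : linear (fun u => J u v w).
  move=> a u u'; rewrite !(linearPl, linearPr) /=.
  by rewrite !scalerDr (addrACA (a *: _)) [LHS]addrACA.
have Jred v w : (forall i : 'I_n.+1, J (basis_vec n i) v w = 0) ->
    forall u, J u v w = 0.
  move=> H0 u.
  pose f : {linear 'rV[K]_n.+1 -> 'rV[K]_n.+1} :=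
    HB.pack (fun u => J u v w) (GRing.isLinear.Build _ _ _ _ _ (Jlin v w)).
  rewrite -[LHS]/(f u) (row_basis u) linear_sum big1 // => i _.
  by rewrite linearZ /= H0 scaler0.
have Jself u w : J u u w = 0.
  have := Janti w u u; rewrite Jcyc => /eqP.
  by rewrite -addr_eq0 -mulr2n -scaler_nat scaler_eq0 pnatr_eq0 /= => /eqP.
have Hle i j l : (i <= j)%N -> (j <= l)%N -> (l <= n)%N ->
    J (basis_vec n i) (basis_vec n j) (basis_vec n l) = 0.
  rewrite leq_eqVlt => /predU1P[->|ij]; first by rewrite Jself.
  rewrite leq_eqVlt => /predU1P[->|jl] ln; first by rewrite Jcyc Jself.
  by apply: H; rewrite ?ij.
have Hall (i j l : nat) : (i <= n)%N -> (j <= n)%N -> (l <= n)%N ->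
    J (basis_vec n i) (basis_vec n j) (basis_vec n l) = 0.
  move=> li lj ll.
  have [ij|ij] := leqP i j; have [jl|jl] := leqP j l; have [il|il] := leqP i l.
  - exact: Hle.
  - lia.
  - by rewrite Janti Hle ?oppr0 //; lia.
  - by rewrite -Jcyc Hle //; lia.
  - by rewrite Jcyc Janti Hle ?oppr0 //; lia.
  - by rewrite Jcyc Hle //; lia.
  - lia.
  - by rewrite -Jcyc Janti Hle ?oppr0 //; lia.
move=> u v w.
apply: (Jred v w) => i; rewrite Jcyc; apply: (Jred _ _) => j.
by rewrite Jcyc; apply: (Jred _ _) => l; rewrite Jcyc Hall // -ltnS.
Qed.

(* All the tables below are of this shape: a chain of length c generated by
   ad e_1, a pairing of e_i with e_(2k+1-i), and diagonal weights w. *)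
Lemma chain_jacobi (c k : nat) (w : nat -> K) (d : K) :
  let B i j := tab i j - tab j i in
  let e := basis_vec n in
  (forall j, (2 <= j <= n)%N -> B j 1 = if (j <= c)%N then e j.+1 else 0) ->
  (forall j, (2 <= j <= n)%N -> B j 0 = w j *: e j) ->
  ((0 < n)%N -> B 1 0 = e 1 + d *: e n) ->
  (forall i j, (2 <= i <= n)%N -> (2 <= j <= n)%N ->
     B i j = (if (i + j == k.*2.+1)%N then (-1) ^+ i else 0) *: e n) ->
  ((2 <= c)%N -> (c < n)%N) ->
  (forall i, (2 <= i <= c)%N -> w i.+1 = w i + 1) ->
  (forall i j, (2 <= i)%N -> (2 <= j)%N -> (i + j = k.*2.+1)%N -> w i + w j = w n) ->
  ((2 <= k)%N -> (k.*2 <= c.+2)%N /\ (k.*2 <= n)%N) ->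
  forall u v x, J u v x = 0.
Proof.
move=> B e B1 B0 B10 Bp cn wc wp kc; apply: tab_jacobi => i j l /andP[ij jl] ln.
rewrite -/e.
have n2 : (2 <= n)%N by lia.
have cltn : (c < n)%N by case: (leqP 2 c) => h; [exact: cn|lia].
pose sg i j : K := if (i + j == k.*2.+1)%N then (-1) ^+ i else 0.
have E1 a : (2 <= a <= n)%N ->
    tab_bracket (e a) (e 1) = if (a <= c)%N then e a.+1 else 0.
  by move=> h; rewrite tab_bracketE; [exact: B1|lia|lia].
have E1' a : (2 <= a <= n)%N ->
    tab_bracket (e 1) (e a) = - if (a <= c)%N then e a.+1 else 0.
  by move=> h; rewrite tab_bracket_anti E1.
have E0 a : (2 <= a <= n)%N -> tab_bracket (e a) (e 0) = w a *: e a.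
  by move=> h; rewrite tab_bracketE; [exact: B0|lia|lia].
have E0' a : (2 <= a <= n)%N -> tab_bracket (e 0) (e a) = - (w a *: e a).
  by move=> h; rewrite tab_bracket_anti E0.
have E01 : tab_bracket (e 0) (e 1) = - (e 1 + d *: e n).
  by rewrite tab_bracket_anti tab_bracketE -/(B 1 0) ?B10 //; lia.
have Ep a b : (2 <= a <= n)%N -> (2 <= b <= n)%N ->
    tab_bracket (e a) (e b) = sg a b *: e n.
  by move=> ha hb; rewrite tab_bracketE; [exact: Bp|lia|lia].
have sgn a : (2 <= a)%N -> sg a n = 0.
  rewrite /sg => h; case: eqP => // h'; have := kc; lia.
have Ean a : (1 <= a <= n)%N -> tab_bracket (e a) (e n) = 0.
  case: (ltnP 1 a) => a1 h.
    by rewrite Ep ?sgn ?scale0r //; lia.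
  have -> : a = 1%N by lia.
  by rewrite E1' 1?[(n <= c)%N]leqNgt ?cltn ?oppr0 //; lia.
have sgC a b : sg b a = - sg a b.
  rewrite /sg addnC; case: eqP => [h|_]; last by rewrite oppr0.
  have ob : odd b = ~~ odd a by lia.
  by rewrite -signr_odd ob -[in RHS]signr_odd; case: odd; rewrite ?opprK.
case: i ij => [|[|i]] ij.
- case: j ij jl => [|[|j]] // ij jl.
  + rewrite E01 E0 ?E1' ?linearZr ?linearNr ?linearDr /= ?E1' ?linearZr /=; [|lia..].
    rewrite E1 ?Ean; [|lia..].
    case: ifP => lc; last by rewrite !(oppr0, linear0r, scaler0, addr0).
    rewrite ?linearNr /= ?E0' ?wc ?scaler0 ?addr0 ?opprK; [|lia..].
    by rewrite scalerDl scale1r scalerN addrAC addrK subrr.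
  + rewrite Ep ?E0 ?E0'; [|lia..].
    rewrite !(linearNr, linearZr) /= E0' ?Ep; [|lia..].
    rewrite (sgC j.+2 l) !scalerN scaleNr scalerN opprK !scalerA -scaleNr -!scalerDl.
    rewrite /sg; case: eqP => [h|_]; last by rewrite !(mul0r, mulr0, oppr0, addr0) scale0r.
    by rewrite -(wp j.+2 l) //; [|lia]; rewrite -[RHS](scale0r (e n)); congr (_ *: _); ring.
- rewrite E1 ?E1' ?Ep ?linearZr /=; [|lia..].
  rewrite Ean ?scaler0 ?add0r; [|lia].
  have [h|h] := eqVneq (j + l)%N k.*2.
    have [kc1 kc2] := kc ltac:(lia).
    rewrite !ifT ?linearNr /= ?Ep; [|lia..].
    rewrite /sg -scaleNr -scalerDl !ifT; [|lia..].
    rewrite -(signr_odd _ j) -(signr_odd _ l).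
    by have -> : odd l = odd j; [lia|rewrite subrr scale0r].
  have H a b : (2 <= a <= n)%N -> (2 <= b <= n)%N -> (a + b != k.*2)%N ->
      tab_bracket (e a) (if (b <= c)%N then e b.+1 else 0) = 0.
    move=> ha hb hab; case: ifP => bc; last by rewrite linear0r.
    rewrite Ep; [|lia..]; rewrite /sg ifF ?scale0r //; lia.
  by rewrite linearNr /= !H ?oppr0 ?addr0 //; lia.
- rewrite !Ep ?linearZr /= ?Ean ?scaler0 ?addr0 //; lia.
Qed.

End Bracket.

Definition tab_lie n (tab : nat -> nat -> 'rV[K]_n.+1)
    (jac : forall u v w, tab_bracket tab u (tab_bracket tab v w)
       + tab_bracket tab v (tab_bracket tab w u)
       + tab_bracket tab w (tab_bracket tab u v) = 0) : lieAlgebra K :=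
  LieAlgebra (@tab_bracket_anti n tab) jac.

Definition s1_tab (n : nat) (beta : K) (i j : nat) : 'rV[K]_n.+1 :=
  let e := basis_vec n in
  if (2 <= i <= n.-1)%N && (j == 1)%N then e i.+1
  else if (i == 1)%N && (j == 0)%N then e 1
  else if (2 <= i <= n)%N && (j == 0)%N then (i%:R - 2 + beta) *: e i
  else 0.

Definition tau1_tab (m : nat) (alpha : K) (i j : nat) : 'rV[K]_(m.*2).+1 :=
  let e := basis_vec m.*2 in
  if (2 <= i <= m.*2 - 2)%N && (j == 1)%N then e i.+1
  else if (2 <= i <= m)%N && (j == m.*2.+1 - i)%N then (-1) ^+ i *: e m.*2
  else if (i == 1)%N && (j == 0)%N then e 1
  else if (2 <= i <= m.*2 - 1)%N && (j == 0)%N then (i%:R - 2 + alpha) *: e i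
  else if (i == m.*2)%N && (j == 0)%N then
    (m.*2%:R - 3 + 2 * alpha) *: e m.*2
  else 0.

Definition tau2_tab (m i j : nat) : 'rV[K]_(m.*2).+1 :=
  let e := basis_vec m.*2 in
  if (2 <= i <= m.*2 - 2)%N && (j == 1)%N then e i.+1
  else if (2 <= i <= m)%N && (j == m.*2.+1 - i)%N then (-1) ^+ i *: e m.*2
  else if (i == 1)%N && (j == 0)%N then e 1 + e m.*2
  else if (2 <= i <= m.*2 - 1)%N && (j == 0)%N then (i%:R - m%:R) *: e i
  else if (i == m.*2)%N && (j == 0)%N then e m.*2
  else 0.

(* The pairing is a cocycle only for k within the bounds required by Ltilde. *)
Definition Ltilde_tab (n k i j : nat) : 'rV[K]_n.+2 :=
  let e := basis_vec n.+1 in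
  if (2 <= i <= n)%N && (j == 1)%N then e i.+1
  else if (2 <= i <= k)%N && (j == k.*2.+1 - i)%N then (-1) ^+ i *: e n.+1
  else if (i == 1)%N && (j == 0)%N then e 1
  else if (2 <= i <= n.+1)%N && (j == 0)%N then
    (n%:R + i%:R - k.*2%:R) *: e i
  else 0.

Local Ltac table_cases :=
  repeat (case: ifP; let h := fresh in move=> h; try (exfalso; lia));
  rewrite ?subr0 ?sub0r ?scale0r ?addr0 ?scale1r //; try lia.

Lemma s1_jacobi n beta u v w (b := tab_bracket (s1_tab n beta)) :
  b u (b v w) + b v (b w u) + b w (b u v) = 0.
Proof.
apply: (@chain_jacobi _ _ n.-1 0 (fun i => i%:R - 2 + beta) 0); rewrite /s1_tab.
- by move=> j hj; table_cases.
- by move=> j hj; table_cases.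
- by move=> hn; table_cases.
- by move=> i j hi hj; table_cases.
- lia.
- by move=> i hi; rewrite -natr1; ring.
- lia.
- lia.
Qed.

Lemma tau1_jacobi m alpha u v w (b := tab_bracket (tau1_tab m alpha)) :
  b u (b v w) + b v (b w u) + b w (b u v) = 0.
Proof.
apply: (@chain_jacobi _ _ (m.*2 - 2) m (fun i => if i == m.*2
  then m.*2%:R - 3 + 2 * alpha else i%:R - 2 + alpha) 0); rewrite /tau1_tab.
- by move=> j hj; table_cases.
- by move=> j hj; table_cases; congr (_ *: basis_vec _ _); lia.
- by move=> hn; table_cases.
- move=> i j hi hj; table_cases.
  by rewrite -scaleNr; congr (_ *: _); rewrite -(signr_odd _ i) -(signr_odd _ j);
    have -> : odd i = ~~ odd j; [lia|case: odd; rewrite ?opprK].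
- lia.
- by move=> i hi; table_cases; rewrite -natr1; ring.
- move=> i j hi hj hij; table_cases; have <- : (i + j - 1)%N = m.*2 by lia.
  by rewrite natrB ?natrD; [ring|lia].
- lia.
Qed.

Lemma tau2_jacobi m u v w (b := tab_bracket (tau2_tab m)) :
  b u (b v w) + b v (b w u) + b w (b u v) = 0.
Proof.
apply: (@chain_jacobi _ _ (m.*2 - 2) m
  (fun i => if i == m.*2 then 1 else i%:R - m%:R) 1); rewrite /tau2_tab.
- by move=> j hj; table_cases.
- by move=> j hj; table_cases; congr (basis_vec _ _); lia.
- by move=> hn; table_cases.
- move=> i j hi hj; table_cases.
  by rewrite -scaleNr; congr (_ *: _); rewrite -(signr_odd _ i) -(signr_odd _ j);
    have -> : odd i = ~~ odd j; [lia|case: odd; rewrite ?opprK].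
- lia.
- by move=> i hi; table_cases; rewrite -natr1; ring.
- move=> i j hi hj hij; table_cases.
  have -> : i%:R - m%:R + (j%:R - m%:R) = (i + j)%:R - (m + m)%:R :> K.
    by rewrite !natrD; ring.
  by rewrite hij addnn -natr1; ring.
- lia.
Qed.

Lemma Ltilde_jacobi n k (hk : (2 <= k <= n./2)%N) u v w
    (b := tab_bracket (Ltilde_tab n k)) :
  b u (b v w) + b v (b w u) + b w (b u v) = 0.
Proof.
apply: (@chain_jacobi _ _ n k (fun i => n%:R + i%:R - k.*2%:R) 0);
  rewrite /Ltilde_tab.
- by move=> j hj; table_cases.
- by move=> j hj; table_cases.
- by move=> hn; table_cases.
- move=> i j hi hj; table_cases.
  by rewrite -scaleNr; congr (_ *: _); rewrite -(signr_odd _ i) -(signr_odd _ j);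
    have -> : odd i = ~~ odd j; [lia|case: odd; rewrite ?opprK].
- lia.
- by move=> i hi; rewrite -natr1; ring.
- move=> i j hi hj hij.
  have -> : n%:R + i%:R - k.*2%:R + (n%:R + j%:R - k.*2%:R)
      = n%:R + n%:R + (i + j)%:R - k.*2%:R - k.*2%:R :> K by rewrite natrD; ring.
  by rewrite hij -!natr1; ring.
- lia.
Qed.

Definition s1 (n : nat) (beta : K) : lieAlgebra K := tab_lie (@s1_jacobi n beta).

Definition s1_nilradical (n : nat) (beta : K) : {vspace s1 n beta} :=
  <<[seq basis_vec n i | i <- iota 1 n]>>%VS.

Definition tau1 (m : nat) (alpha : K) : lieAlgebra K :=
  tab_lie (@tau1_jacobi m alpha).

Definition tau2 (m : nat) : lieAlgebra K := tab_lie (@tau2_jacobi m).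

Definition Ltilde (n k : nat) (hk : (2 <= k <= n./2)%N) : lieAlgebra K :=
  tab_lie (Ltilde_jacobi hk).

End Tables.

Arguments tau2 K m : clear implicits.
Arguments Ltilde K {n k} hk.

(* Main.v *)
From HB Require Import structures.
Require Import Defs.
From mathcomp Require Import all_boot all_order all_algebra.
From mathcomp Require Import all_reals complex.
From mathcomp Require Import zify ring.
Set Implicit Arguments.
Unset Strict Implicit.
Unset Printing Implicit Defensive.
Import GRing.Theory Num.Theory.
Local Open Scope ring_scope.
Local Open Scope complex_scope.

(** Write psi for the cocycle, v for a generator of V, and tau for the scalar
with [v, x] = tau v.  All four families of target algebras have one shape: a
chain e_(j+1) = [e_j, e_1], weights [e_j, x] = w_j e_j, at most one pairing
[e_i, e_(2k+1-i)] = (-1)^i e_top, and possibly a defect [e_1, x] = e_1 + d e_top.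
The predicate chain_presentation records this shape, and two algebras of the
same dimension with bases satisfying the same presentation are isomorphic
(iso_of_presentation).  So it suffices to find in the extension a basis of
this shape.

The shape is almost forced.  Choose X over x + mu e_n, Y over e_1 + nu e_2 and B
over a multiple of e_2, and define the rest of the basis as the chain B, [B,Y],
[[B,Y],Y], and so on.  If [Y,X] = Y modulo V and [B,X] = beta B, the Jacobi identity gives the
weights of the whole chain (chain_weight).  Brackets of two chain elements are
central in the nilradical, so Jacobi with Y gives
[c_i, c_j] = (-1)^i [B, c_(i+j)] (chain_pairing), which vanishes for i + j even.
Jacobi with X says that a nonzero [B, c_s] has weight both tau and 2 beta + s;
hence at most one s, necessarily odd, occurs (pairing_support).

As the extension is non-split, e_n pairs nontrivially with e_1 or e_2.
If psi(e_2, e_n) = 0, then psi(e_n, e_1) is nonzero and the chain of the model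
algebra becomes longer by one step, ending in V, so tau = n - 1 + beta.  Either
there is no pairing, which is s1 of size n+1, or there is one at s = 2k-3, which
forces beta = n+2-2k and is Ltilde (extension_type_chain).
If psi(e_2, e_n) is nonzero, then n - 2 is odd and tau = n - 2 + 2 beta.  A
multiple of e_2 added to e_1 makes psi(e_n, Y) vanish; when this multiple is
nonzero, comparing the two values of tau gives beta = 1, so Y is still a weight
vector.  The defect [Y,X] - Y in V can be removed if tau differs from 1, which
gives tau1.  If tau = 1 a nonzero defect can only be scaled to the last basis
vector, at the cost of a square root, which gives tau2
(extension_type_pairing). *)

(** * Chains in a Lie algebra *)

Section LieChain.
Variables (K : numFieldType) (M : lieAlgebra K).
Implicit Types x y z : M.

Lemma liexx x : [lie x, x] = 0.
Proof.
have /eqP := lie_anti x x.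
by rewrite -addr_eq0 -mulr2n -scaler_nat scaler_eq0 pnatr_eq0 /= => /eqP.
Qed.

(** The Jacobi identity as the statement that bracketing with z on the right is a
derivation, the form in which every induction along a chain uses it. *)
Lemma lie_derivation x y z :
  [lie [lie x, y], z] = [lie [lie x, z], y] + [lie x, [lie y, z]].
Proof.
rewrite (lie_anti [lie x, y] z) (lie_anti [lie x, z] y) (lie_anti x z).
rewrite linearNr opprK /=; apply/esym/eqP; rewrite -addr_eq0 [X in X + _]addrC.
by apply/eqP; exact: lie_jacobi.
Qed.

Variables X Y B : M.

Definition chain i : M := iter i (fun u => [lie u, Y]) B.

(** Each application of ad Y raises the weight by one, because Y has weight 1 up to
a part of [Y, X] that is invisible on the chain; the second hypothesis tolerates
such a part. *)
Lemma chain_weight w :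
  [lie B, X] = w *: B ->
  (forall i, [lie chain i, [lie Y, X]] = chain i.+1) ->
  forall i, [lie chain i, X] = (w + i%:R) *: chain i.
Proof.
move=> hB hY; elim=> [|i IH]; first by rewrite addr0.
rewrite [chain i.+1]/= lie_derivation IH hY linearZl /=.
by rewrite -natr1 addrA [RHS]scalerDl scale1r.
Qed.

Hypothesis pair_central : forall i j, [lie [lie chain i, chain j], Y] = 0.

(** Bracketing [c_i, c_j] with Y gives 0 = [c_(i+1), c_j] + [c_i, c_(j+1)], so one
step can be moved from the left to the right at the price of a sign. *)
Lemma chain_pairing i j :
  [lie chain i, chain j] = (-1) ^+ i *: [lie B, chain (i + j)].
Proof.
elim: i j => [|i IH] j; first by rewrite scale1r.
have /eqP := pair_central i j.
rewrite lie_derivation addr_eq0 => /eqP; rewrite -/(chain i.+1) => ->.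
by rewrite (IH j.+1) addnS exprS mulN1r scaleNr.
Qed.

(** By the previous lemma this is, up to sign, [c_i, c_i]. *)
Lemma chain_pairing_even i : [lie B, chain i.*2] = 0.
Proof.
have := chain_pairing i i; rewrite liexx addnn => /esym/eqP.
by rewrite scaler_eq0 signr_eq0 => /eqP.
Qed.

Lemma chain_pairing_weight w t i :
  (forall j, [lie chain j, X] = (w + j%:R) *: chain j) ->
  [lie [lie B, chain i], X] = t *: [lie B, chain i] ->
  [lie B, chain i] != 0 -> t = 2 * w + i%:R.
Proof.
move=> hw; rewrite lie_derivation (hw i) (hw 0%N : [lie B, X] = _) addr0.
rewrite linearZl linearZr /= -scalerDl => /eqP hwt /negPf nz.
move: hwt; rewrite -subr_eq0 -scalerBl scaler_eq0 nz orbF.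
by rewrite subr_eq0 => /eqP <-; ring.
Qed.

End LieChain.

(** * Presentations and isomorphisms *)

Section Presentation.
Variable K : numFieldType.

(** The common shape of the bracket tables: b 0 plays the role of x and b i that of
e_i.  The chain ends at b c.+1; in the four families this is b n or its
predecessor.  For k <= 1 there is no pair of indices of sum 2k+1 in the range, so
k = 0 encodes the absence of a pairing; d is the defect of e_1 as a weight vector. *)
Record chain_presentation (M : lieAlgebra K) (b : nat -> M)
    (n c k : nat) (w : nat -> K) (d : K) : Prop := ChainPresentation {
  pres_chain : forall j, (2 <= j <= n)%N ->
    [lie b j, b 1%N] = if (j <= c)%N then b j.+1 else 0;
  pres_weight : forall j, (2 <= j <= n)%N -> [lie b j, b 0%N] = w j *: b j;
  pres_e1 : [lie b 1%N, b 0%N] = b 1%N + d *: b n;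
  pres_pairing : forall i j, (2 <= i <= n)%N -> (2 <= j <= n)%N ->
    [lie b i, b j] = (if (i + j == k.*2.+1)%N then (-1) ^+ i else 0) *: b n
}.

Lemma eq_weight_presentation (M : lieAlgebra K) (b : nat -> M) n c k w w' d :
  (forall j, (2 <= j <= n)%N -> w j = w' j) ->
  chain_presentation b n c k w d -> chain_presentation b n c k w' d.
Proof. by move=> ww' [p1 p0 p10 pp]; split=> // j hj; rewrite -ww' ?p0. Qed.

Lemma triangular_independent (U W : vectType K) n (b : nat -> U)
    (phi : nat -> {linear U -> W}) :
  (forall l, (l < n)%N -> phi l (b l) != 0) ->
  (forall l i, (l < i < n)%N -> phi l (b i) = 0) ->
  forall a : 'I_n -> K, \sum_(i < n) a i *: b i = 0 -> forall i, a i = 0.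
Proof.
move=> hd hu a a0 i; case: i => l; elim/ltn_ind: l => l IH ln.
have := congr1 (phi l) a0; rewrite raddf0 raddf_sum (bigD1 (Ordinal ln)) //=.
rewrite [X in _ + X]big1 => [|[j jn] /=]; last first.
  rewrite -val_eqE /= neq_ltn linearZ => /orP[jl|lj] /=; first by rewrite IH ?scale0r.
  by rewrite hu ?scaler0 // lj.
rewrite addr0 linearZ => /eqP; rewrite scaler_eq0 => /orP[/eqP //|].
by rewrite /= (negPf (hd _ ln)).
Qed.

(** A presentation determines the bracket of any two basis vectors up to
antisymmetry, so the linear map matching the two bases preserves brackets.  The
map is built from the row vectors to M, where it is given by coordinates, and
then inverted. *)
Lemma iso_of_presentation n (tab : nat -> nat -> 'rV[K]_n.+1)
    (jac : forall u v w, tab_bracket tab u (tab_bracket tab v w)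
       + tab_bracket tab v (tab_bracket tab w u)
       + tab_bracket tab w (tab_bracket tab u v) = 0)
    (M : lieAlgebra K) (b : nat -> M) c k w d :
  (0 < n)%N -> (c < n)%N -> \dim {:M} = n.+1 ->
  (forall a : 'I_n.+1 -> K, \sum_(i < n.+1) a i *: b i = 0 -> forall i, a i = 0) ->
  chain_presentation b n c k w d ->
  @chain_presentation (tab_lie jac) (basis_vec K n) n c k w d ->
  lie_isomorphic M (tab_lie jac).
Proof.
move=> n0 cn dimM indep Pb Pe.
have glin : linear (fun u : 'rV[K]_n.+1 => \sum_(i < n.+1) u 0 i *: b i : M).
  move=> a u v; rewrite scaler_sumr -big_split; apply: eq_bigr => i _ /=.
  by rewrite !mxE scalerDl scalerA.
have [g gE] : exists g : {linear 'rV[K]_n.+1 -> M},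
    forall u, g u = \sum_(i < n.+1) u 0 i *: b i.
  pose g0 : {linear 'rV[K]_n.+1 -> M} :=
    HB.pack (fun u => _) (GRing.isLinear.Build _ _ _ _ _ glin).
  by exists g0.
have ge i : (i <= n)%N -> g (basis_vec K n i) = b i.
  move=> lin; rewrite gE (bigD1 (Ordinal (lin : (i < n.+1)%N))) //=.
  rewrite big1 ?addr0 ?mxE ?eqxx ?scale1r // => j.
  by rewrite -val_eqE mxE /= => /negPf->; rewrite scale0r.
have gbr_le i j : (j <= i <= n)%N ->
  g (tab_bracket tab (basis_vec K n i) (basis_vec K n j)) = [lie b i, b j].
  move=> /andP[]; rewrite leq_eqVlt => /predU1P[->|ji] lin.
    by rewrite liexx (liexx (basis_vec K n i : tab_lie jac)) raddf0.
  case: j ji => [|[|j]] ji.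
  - have [i1|i1] := ltnP 1%N i.
      by rewrite (pres_weight Pe) ?i1 // (pres_weight Pb) ?i1 // linearZ /= ge.
    have -> : i = 1%N by lia.
    by rewrite (pres_e1 Pe) (pres_e1 Pb) linearD linearZ /= !ge.
  - rewrite (pres_chain Pe) ?(pres_chain Pb) ?ji //.
    by case: ifP => ic; rewrite ?raddf0 // ge //; lia.
  - by rewrite (pres_pairing Pe) ?(pres_pairing Pb) ?linearZ /= ?ge //; lia.
have gbr i j : (i <= n)%N -> (j <= n)%N ->
  g (tab_bracket tab (basis_vec K n i) (basis_vec K n j)) = [lie b i, b j].
  move=> hi hj; case: (leqP j i) => ij; first by rewrite gbr_le // ij.
  rewrite tab_bracket_anti raddfN /= gbr_le ?(ltnW ij) //.
  by rewrite -lie_anti.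
have gM u v : g (tab_bracket tab u v) = [lie g u, g v].
  rewrite [in LHS]/tab_bracket raddf_sum (gE u) linear_sumlz /=.
  apply: eq_bigr => i _; rewrite raddf_sum linearZl /=.
  rewrite (gE v) linear_sumr scaler_sumr /=; apply: eq_bigr => j _.
  have iln : (i <= n)%N by rewrite -ltnS.
  have jln : (j <= n)%N by rewrite -ltnS.
  by rewrite linearZ linearZr /= scalerA -(gbr i j iln jln) tab_bracketE.
have kerg : lker (linfun g) == 0%VS.
  rewrite -subv0; apply/subvP => u; rewrite memv_ker lfunE memv0 => /eqP gu.
  by apply/eqP/rowP => i; rewrite mxE; apply: (indep (fun i => u 0 i)); rewrite -gE.
have img : limg (linfun g) = fullv.
  apply/eqP; rewrite -dimv_leqif_eq ?subvf // dimM.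
  have := limg_ker_dim (linfun g) fullv.
  by rewrite (eqP kerg) capv0 dimv0 add0n dimvf /dim /= mul1n => ->.
pose f : 'Hom(M, 'rV[K]_n.+1) := ((linfun g)^-1)%VF.
have fg : cancel g f.
  by move=> u; rewrite /f -[g u](lfunE g) lker0_lfunK.
have gf : cancel f g.
  move=> x; rewrite /f -[LHS](lfunE g) limg_lfunVK //.
  by rewrite img memvf.
exists (GRing.Linear.clone _ _ _ _ f _ : {linear M -> tab_lie jac}).
split=> /=; first by exists g.
move=> x y; apply: (can_inj fg); rewrite gf; symmetry; etransitivity; first exact: gM.
by rewrite !gf.
Qed.

End Presentation.

(** * Presentations of the tabulated algebras *)

Section Tables.
Variables (K : numFieldType) (n c k : nat) (w : nat -> K) (d : K).
Local Notation e := (basis_vec K n).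

(** The shape shared by the four tables, with the last weight merged into w. *)
Definition chain_table (i j : nat) : 'rV[K]_n.+1 :=
  if (2 <= i <= c)%N && (j == 1)%N then e i.+1
  else if (2 <= i <= k)%N && (j == k.*2.+1 - i)%N then (-1) ^+ i *: e n
  else if (i == 1)%N && (j == 0)%N then e 1 + d *: e n
  else if (2 <= i <= n)%N && (j == 0)%N then w i *: e i
  else 0.

Let table_1 i : (2 <= i)%N -> chain_table i 1 = if (i <= c)%N then e i.+1 else 0.
Proof.
move=> i2; rewrite /chain_table i2 /= andbT; case: ifP => // _.
by rewrite ifF ?andbF //; lia.
Qed.

Let table_0 i : (2 <= i <= n)%N -> chain_table i 0 = w i *: e i.
Proof.
case/andP=> i2 lin; rewrite /chain_table i2 lin /= andbF (gtn_eqF i2).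
by have -> : (i <= k)%N && (0 == k.*2.+1 - i)%N = false by lia.
Qed.

Let table_pair i j : (2 <= i)%N -> (2 <= j)%N ->
  chain_table i j = (if (i <= k)%N && (i + j == k.*2.+1)%N then (-1) ^+ i else 0) *: e n.
Proof.
move=> i2 j2; rewrite /chain_table i2 !(gtn_eqF (ltnW j2), gtn_eqF j2) !andbF /=.
have -> : (i <= k)%N && (j == k.*2.+1 - i)%N = (i <= k)%N && (i + j == k.*2.+1)%N.
  by case: leqP => //= ik; rewrite -(eqn_add2l i) subnKC //; lia.
by case: ifP => // _; rewrite scale0r.
Qed.

Let table_1j j : (2 <= j)%N -> chain_table 1 j = 0.
Proof. by case: j. Qed.

(** A pair of indices of sum 2k+1 has exactly one entry at most k, so of the two
products e_i e_j and e_j e_i exactly one is listed; the parities differ, which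
absorbs the sign of the antisymmetrization. *)
Lemma presentation_of_table (tab : nat -> nat -> 'rV[K]_n.+1)
    (jac : forall u v x, tab_bracket tab u (tab_bracket tab v x)
       + tab_bracket tab v (tab_bracket tab x u)
       + tab_bracket tab x (tab_bracket tab u v) = 0) :
  (0 < n)%N -> (forall i j, tab i j = chain_table i j) ->
  @chain_presentation K (tab_lie jac) e n c k w d.
Proof.
move=> n0 tabE.
have brE i j : (i <= n)%N -> (j <= n)%N ->
    [lie (e i : tab_lie jac), e j] = chain_table i j - chain_table j i.
  by move=> hi hj; rewrite -!tabE; apply: tab_bracketE.
split.
- by move=> j /andP[j2 jn]; rewrite brE // table_1 // table_1j // subr0.
- by move=> j /[dup] hj /andP[j2 jn]; rewrite brE // table_0 // subr0.
- by rewrite brE // subr0.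
- move=> i j /andP[i2 lin] /andP[j2 ljn]; rewrite brE // !table_pair // -scalerBl.
  rewrite [(j + i)%N]addnC; case: eqP => [ij|_]; last by rewrite !andbF subr0.
  have oij : odd i = ~~ odd j by lia.
  have -> : (j <= k)%N = ~~ (i <= k)%N by lia.
  rewrite !andbT -(signr_odd _ i) -(signr_odd _ j) oij.
  by congr (_ *: _); case: (i <= k)%N; case: (odd j); rewrite ?subr0 ?sub0r ?opprK.
Qed.

End Tables.

Section Targets.
Variable K : numFieldType.

Lemma presentation_s1 n beta : (0 < n)%N ->
  @chain_presentation K (s1 n beta) (basis_vec K n) n n.-1 0
    (fun j => j%:R - 2 + beta) 0.
Proof.
move=> n0; apply: presentation_of_table => // i j; rewrite /s1_tab /chain_table.
have -> : (2 <= i <= 0)%N = false by lia.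
by rewrite scale0r addr0.
Qed.

Lemma presentation_Ltilde n k (hk : (2 <= k <= n./2)%N) :
  @chain_presentation K (Ltilde K hk) (basis_vec K n.+1) n.+1 n k
    (fun j => n%:R + j%:R - k.*2%:R) 0.
Proof.
by apply: presentation_of_table => // i j; rewrite /Ltilde_tab /chain_table scale0r addr0.
Qed.

Let split_last m i j : (2 <= m)%N ->
  (2 <= i <= m.*2)%N && (j == 0)%N
    = ((2 <= i <= m.*2 - 1)%N && (j == 0)%N) || ((i == m.*2)%N && (j == 0)%N).
Proof. by move=> m2; lia. Qed.

Lemma presentation_tau1 m beta : (2 <= m)%N ->
  @chain_presentation K (tau1 m beta) (basis_vec K m.*2) m.*2 (m.*2 - 2) m
    (fun j => if j == m.*2 then m.*2%:R - 3 + 2 * beta else j%:R - 2 + beta) 0.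
Proof.
move=> m2; apply: presentation_of_table => [|i j]; first lia.
rewrite /tau1_tab /chain_table scale0r addr0 split_last //.
case: (eqVneq i m.*2) => [->|im]; last by rewrite andFb orbF.
have -> : (2 <= m.*2 <= m.*2 - 1)%N = false by lia.
by [].
Qed.

Lemma presentation_tau2 m : (2 <= m)%N ->
  @chain_presentation K (tau2 K m) (basis_vec K m.*2) m.*2 (m.*2 - 2) m
    (fun j => if j == m.*2 then 1 else j%:R - m%:R) 1.
Proof.
move=> m2; apply: presentation_of_table => [|i j]; first lia.
rewrite /tau2_tab /chain_table scale1r split_last //.
case: (eqVneq i m.*2) => [->|im]; last by rewrite andFb orbF.
have -> : (2 <= m.*2 <= m.*2 - 1)%N = false by lia.
by rewrite scale1r.
Qed.

End Targets.

(** * The model filiform algebra *)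

Section Model.
Variables (K : numFieldType) (n : nat) (beta : K).

Local Notation e i := (basis_vec K n i : lie_sort (s1 n beta)).
Local Notation N := (s1_nilradical n beta).

(** With zero past the end of the basis, the relation [e_i, e_1] = e_(i+1) holds
also at the end of the chain, and the lemmas below need no upper bound on the
indices. *)
Lemma basis_vec_over i : (n < i)%N -> e i = 0.
Proof.
move=> ni; apply/rowP => j; rewrite !mxE.
by have := ltn_ord j; case: eqP => //; lia.
Qed.

Lemma basis_vec_neq0 i : (i <= n)%N -> e i != 0.
Proof.
move=> lin; apply/eqP => /rowP/(_ (Ordinal (lin : (i < n.+1)%N))).
by rewrite !mxE eqxx => /eqP; rewrite oner_eq0.
Qed.

Lemma s1_br1 i : (2 <= i)%N -> [lie e i, e 1%N] = e i.+1.
Proof.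
move=> i2; case: (leqP i n) => lin; last first.
  by rewrite (basis_vec_over lin) linear0l basis_vec_over //; lia.
rewrite (pres_chain (presentation_s1 beta _)) ?i2 //; last lia.
by case: leqP => // ni; rewrite basis_vec_over //; lia.
Qed.

Lemma s1_br0 i : (2 <= i)%N -> [lie e i, e 0%N] = (i%:R - 2 + beta) *: e i.
Proof.
move=> i2; case: (leqP i n) => lin; last by rewrite basis_vec_over // linear0l scaler0.
by rewrite (pres_weight (presentation_s1 beta _)) ?i2 //; lia.
Qed.

Lemma s1_br20 : [lie e 2%N, e 0%N] = beta *: e 2%N.
Proof. by rewrite s1_br0 //; congr (_ *: _); ring. Qed.

Lemma s1_br10 : (0 < n)%N -> [lie e 1%N, e 0%N] = e 1%N.
Proof. by move=> n0; rewrite (pres_e1 (presentation_s1 beta n0)) scale0r addr0. Qed.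

Lemma s1_br_abel i j : (2 <= i)%N -> (2 <= j)%N -> [lie e i, e j] = 0.
Proof.
move=> i2 j2; case: (leqP i n) => lin; last by rewrite basis_vec_over ?linear0l.
case: (leqP j n) => ljn; last by rewrite (basis_vec_over ljn) linear0r.
rewrite (pres_pairing (presentation_s1 beta _)) ?i2 ?j2 //; last lia.
by rewrite ifF ?scale0r //; lia.
Qed.

Lemma e_nilradical i : (1 <= i)%N -> e i \in N.
Proof.
move=> i1; case: (leqP i n) => lin; last by rewrite basis_vec_over // mem0v.
by apply/memv_span/map_f; rewrite mem_iota; lia.
Qed.

Lemma nilradical_linear0 (W : vectType K) (g : {linear s1 n beta -> W}) :
  (forall i, (1 <= i <= n)%N -> g (e i) = 0) -> forall y, y \in N -> g y = 0.
Proof.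
move=> g0 y yN; have : (N <= lker (linfun g))%VS.
  apply/span_subvP => u /mapP[j]; rewrite mem_iota => hj ->.
  by rewrite memv_ker lfunE g0 //; lia.
by move/subvP/(_ y yN); rewrite memv_ker lfunE => /eqP.
Qed.

End Model.

(** * One-dimensional spaces *)

Section Line.
Variables (K : numFieldType) (V : vectType K).
Hypothesis dimV : \dim {:V} = 1%N.

Lemma line_generator : exists v : V, v != 0 /\ forall u : V, exists a : K, u = a *: v.
Proof.
exists (vpick {:V}); split; first by rewrite vpick0 -dimv_eq0 dimV.
move=> u; apply/vlineP.
have -> : <[vpick {:V}]>%VS = fullv; last by rewrite memvf.
apply/eqP; rewrite -dimv_leqif_eq ?subvf // dimV dim_vline vpick0 -dimv_eq0 dimV //.
Qed.

Lemma line_ratio (u v : V) : v != 0 -> exists a : K, u = a *: v.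
Proof.
move=> v0; have [g [g0 hg]] := line_generator.
have [[a ->] [b hb]] := (hg u, hg v); exists (a / b).
have b0 : b != 0 by apply: contraNneq v0 => b0; rewrite hb b0 scale0r.
by rewrite hb scalerA divfK.
Qed.

Lemma line_scalar (f : 'End(V)) : exists a : K, forall v, f v = a *: v.
Proof.
have [g [g0 hg]] := line_generator.
have [t ht] := hg (f g); exists t => v; have [a ->] := hg v.
by rewrite linearZ /= ht !scalerA mulrC.
Qed.

End Line.

(** * Adapted families in an extension *)

Section Adapted.
Variables (K : numFieldType) (n : nat) (beta : K) (V : vectType K).
Variable E : extension (s1_nilradical n beta) V.
Hypothesis n_ge3 : (3 <= n)%N.
Local Notation e i := (basis_vec K n i : lie_sort (s1 n beta)).
Local Notation N := (s1_nilradical n beta).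
Local Notation M := (ext_lie E).
Local Notation psi := (ext_psi E).

Lemma dim_ext : \dim {:V} = 1%N -> \dim {:M} = n.+2.
Proof.
rewrite dimvf => dV.
by rewrite dimvf -[LHS]/(1 * n.+1 + dim V)%N dV mul1n addn1.
Qed.

Lemma ext_lieE (p q : M) :
  [lie p, q] = ([lie p.1, q.1], psi p.1 q.1 + ext_theta E p.1 q.2 - ext_theta E q.1 p.2) :> M.
Proof. by []. Qed.

Lemma ext_lie_nilradical (p q : M) : p.1 \in N -> q.1 \in N ->
  [lie p, q] = ([lie p.1, q.1], psi p.1 q.1) :> M.
Proof.
move=> pN qN; rewrite ext_lieE.
by rewrite (ext_theta_nilradical E pN) (ext_theta_nilradical E qN) !zero_lfunE addr0 subr0.
Qed.

Lemma ext_lie_central (v : V) (q : M) : q.1 \in N -> [lie ((0, v) : M), q] = 0.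
Proof.
move=> qN; rewrite ext_lie_nilradical ?mem0v //=.
by congr pair; exact: linear0l.
Qed.

(** The vector e_n is central in N, so non-splitness yields some e_j with
psi(e_n, e_j) nonzero.  For j >= 3, e_j = [e_(j-1), e_1] and the cocycle identity
gives psi(e_n, e_j) = 0, which leaves j = 1 and j = 2. *)
Lemma nonsplit_witness : ext_nonsplit E ->
  psi (e 2%N) (e n) != 0 \/ psi (e n) (e 1%N) != 0.
Proof.
move=> ns; have [h2|] := eqVneq (psi (e 2%N) (e n)) 0; last by left.
right; apply/eqP => h1; have /eqP := @basis_vec_neq0 K n beta n (leqnn n); apply.
apply: (ns (e n)); (split; first by apply: e_nilradical; lia).
- apply: (nilradical_linear0 (g := psi (e n))) => j hj.
  case: j hj => [|[|[|j]]] // hj /=.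
    by rewrite ext_psi_anti h2 oppr0.
  have := ext_psi_cocycle E (e n) (e j.+2) (e 1%N).
  rewrite !(ext_theta_nilradical E) ?e_nilradical //; [|lia..].
  rewrite !zero_lfunE !addr0 s1_br1 // s1_br_abel //; [|lia].
  rewrite (lie_anti (e 1%N)) s1_br1; [|lia].
  by rewrite (basis_vec_over beta (ltnSn n)) !(linear0r, oppr0, addr0).
- apply: (nilradical_linear0 (g := lie_bracket (s1 n beta) (e n))) => j hj.
  case: j hj => [|[|j]] // hj /=; last by rewrite s1_br_abel //; lia.
  by rewrite s1_br1 ?(basis_vec_over beta (ltnSn n)) //; lia.
Qed.

Variable tau : K.
Hypothesis theta_e0 : forall v, ext_theta E (e 0%N) v = - (tau *: v).

(** The cocycle identity with e_0: psi is equivariant, so a nonzero value on two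
commuting weight vectors has the sum of their weights. *)
Lemma psi_weight (y z : s1 n beta) (a b : K) : y \in N -> z \in N ->
  [lie y, z] = 0 -> [lie y, e 0%N] = a *: y -> [lie z, e 0%N] = b *: z ->
  psi y z != 0 -> tau = a + b.
Proof.
move=> yN zN yz ya zb nz; have := ext_psi_cocycle E y z (e 0%N).
rewrite !(ext_theta_nilradical E yN, ext_theta_nilradical E zN) !zero_lfunE !addr0.
rewrite theta_e0 yz linear0r addr0 zb (lie_anti _ y) ya.
rewrite linearZr linearNr linearZr /= (ext_psi_anti E z y) scalerN opprK.
rewrite -scalerDl => /eqP; rewrite -scalerBl scaler_eq0 (negPf nz) orbF subr_eq0.
by rewrite addrC => /eqP <-.
Qed.

(* The vectors X, Y, B below are the candidates for e_0, e_1, e_2.  Adding mu e_n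
   to x changes [Y, X] and [B, X] only inside V; adding nu e_2 to e_1 changes the
   last step of the chain; lam sets the scale of the pairing relative to the
   chain; delta and gam absorb the V-parts of [Y, X] and [B, X]
   when tau differs from 1 and from beta, respectively. *)
Variable mu : K.
Let X : M := (e 0%N + mu *: e n, 0).

Lemma theta_X v : ext_theta E X.1 v = - (tau *: v).
Proof.
have eN : e n \in N by apply: e_nilradical; lia.
rewrite /= linearD linearZ /= add_lfunE scale_lfunE theta_e0.
by rewrite (ext_theta_nilradical E eN) zero_lfunE scaler0 addr0.
Qed.

Lemma lie_central_X v : [lie ((0, v) : M), X] = tau *: ((0, v) : M).
Proof.
rewrite ext_lieE theta_X opprK; congr pair; first by rewrite linear0l scaler0.
by rewrite /= linear0l linear0 !add0r.
Qed.

Lemma lie_BX lam gam (B : M := (lam *: e 2%N, gam)) :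
  [lie B, X] = beta *: B + (0, lam *: psi (e 2%N) X.1 + (tau - beta) *: gam).
Proof.
rewrite ext_lieE theta_X opprK; congr pair; last first.
  rewrite /= linearZl /= linear0 addr0 [RHS]addrCA scalerBl; congr (_ + _).
  by rewrite addrC subrK.
rewrite /= addr0 linearZl /= !linearDr !linearZr /=.
rewrite s1_br20 (@s1_br_abel K n beta 2 n) //; last lia.
by rewrite scaler0 addr0 !scalerA mulrC.
Qed.

Variables (nu : K) (delta : V).
Let Y : M := (e 1%N + nu *: e 2%N, delta).

Let YN : Y.1 \in N.
Proof. by rewrite rpredD ?rpredZ ?e_nilradical. Qed.

(** The condition says that nu = 0 or that e_2 has the same weight 1 as e_1. *)
Lemma lie_YX : nu * beta = nu ->
  [lie Y, X] = Y + (0, psi Y.1 X.1 + (tau - 1) *: delta).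
Proof.
move=> hnu; rewrite ext_lieE theta_X opprK; congr pair; last first.
  by rewrite /= linear0 addr0 addrCA scalerBl scale1r [delta + _]addrC subrK.
rewrite /= addr0 linearDl !linearDr !linearZl !linearZr /=.
rewrite s1_br10 ?s1_br20; last lia.
rewrite (@s1_br_abel K n beta 2 n) //; last lia.
rewrite (lie_anti (e 1%N)) s1_br1; last lia.
by rewrite (basis_vec_over beta (ltnSn n)) oppr0 !scaler0 !addr0 scalerA hnu.
Qed.

Variables (lam : K) (gam : V).
Let B : M := (lam *: e 2%N, gam).
Local Notation ch := (chain Y B).

Lemma chain_fst i : (ch i).1 = lam *: e i.+2.
Proof.
elim: i => // i IH; rewrite [ch _]/= ext_lieE IH /= linearZl /=.
by rewrite linearDr linearZr /= s1_br1 // s1_br_abel // scaler0 addr0.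
Qed.

Lemma chain_nilradical i : (ch i).1 \in N.
Proof. by rewrite chain_fst rpredZ // e_nilradical. Qed.

Lemma chain_pair i j :
  [lie ch i, ch j] = (0, lam ^+ 2 *: psi (e i.+2) (e j.+2)) :> M.
Proof.
rewrite ext_lie_nilradical ?chain_nilradical // !chain_fst !linearZl !linearZr /=.
by rewrite s1_br_abel // !scaler0 scalerA -expr2.
Qed.

Lemma chain_pair_central i j : [lie [lie ch i, ch j], Y] = 0.
Proof. by rewrite chain_pair ext_lie_central. Qed.

Lemma chain_last : ch n.-1 = (0, lam *: psi (e n) Y.1) :> M.
Proof.
have -> : n.-1 = n.-2.+1 by lia.
rewrite [ch _]/= ext_lie_nilradical ?chain_nilradical // chain_fst.
have -> : n.-2.+2 = n by lia.
rewrite !linearZl linearDr linearZr /= s1_br1 ?s1_br_abel; [|lia..].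
by rewrite (basis_vec_over beta (ltnSn n)) scaler0 addr0 scaler0.
Qed.

Variable (zeta : V) (d : K).
Let z : M := (0, zeta).
Hypothesis HY : [lie Y, X] = Y + d *: z.
Hypothesis HB : [lie B, X] = beta *: B.

Lemma chain_X i : [lie ch i, X] = (beta + i%:R) *: ch i.
Proof.
apply: (chain_weight HB) => j; rewrite HY linearDr linearZr /=.
by rewrite (lie_anti _ z) ext_lie_central ?chain_nilradical // oppr0 scaler0 addr0.
Qed.

(** The pairing is concentrated on one value of s: evenness kills [B, c_s], and a
nonzero [B, c_s] lies in V, of weight tau, while its weight as a bracket is
the sum of the weights of B and c_s. *)
Lemma pairing_support s : psi (e 2%N) (e s.+2) != 0 -> lam != 0 ->
  odd s /\ tau = 2 * beta + s%:R.
Proof.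
move=> nz lam0; have nzM : [lie B, ch s] != 0.
  rewrite -[B]/(ch 0%N) chain_pair; apply: contraNneq nz => -[] /eqP.
  by rewrite scaler_eq0 expf_eq0 (negPf lam0).
split.
  apply: contraR nzM => /even_halfK <-.
  by rewrite (chain_pairing_even chain_pair_central).
apply: (chain_pairing_weight chain_X) nzM.
by rewrite -[B]/(ch 0%N) chain_pair lie_central_X.
Qed.

(** Only the entries of index at most n are taken from the chain.  The last one is
a free vector of V: when the chain stops at index n it is a pairing instead. *)
Definition adapted i : M :=
  if i == n.+1 then z else if i is j.+1 then if j is j'.+1 then ch j' else Y else X.

Lemma adapted_chain i : (2 <= i <= n)%N -> adapted i = ch i.-2.
Proof. by case: i => [|[|i]] // hi; rewrite /adapted ifF //; lia. Qed.

Lemma adapted_independent : zeta != 0 -> lam != 0 ->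
  forall a : 'I_n.+2 -> K, \sum_(i < n.+2) a i *: adapted i = 0 -> forall i, a i = 0.
Proof.
move=> zeta0 lam0.
(* The coordinates on L, ordered by index and followed by the V-component, make
   the family triangular; multiplying by zeta gives them the common codomain V. *)
have philin l : linear (fun p : M => if l == n.+1 then p.2 else p.1 0 (inord l) *: zeta).
  by move=> a p q; case: ifP => // _; rewrite /= !mxE scalerDl scalerA.
pose phi l : {linear M -> V} := HB.pack
  (fun p : M => if l == n.+1 then p.2 else p.1 0 (inord l) *: zeta)
  (GRing.isLinear.Build _ _ _ _ _ (philin l)).
have phiE l p : phi l p = if l == n.+1 then p.2 else p.1 0 (inord l) *: zeta by [].
apply: (triangular_independent (phi := phi)) => [l ln | l i lin].
- rewrite phiE; case: ifP => ln1; first by rewrite /adapted ln1.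
  rewrite scaler_eq0 (negPf zeta0) orbF.
  case: l ln ln1 => [|[|l]] ln ln1; rewrite /adapted ?ln1.
  + rewrite /= !mxE inordK //; have -> : (0 == n)%N = false by lia.
    by rewrite mulr0 addr0 oner_eq0.
  + rewrite /= !mxE inordK; last lia.
    by rewrite mulr0 addr0 oner_eq0.
  + by rewrite chain_fst !mxE inordK ?eqxx ?mulr1 //; lia.
- rewrite phiE ifF; last lia.
  case: (eqVneq i n.+1) => [->|in1]; first by rewrite /adapted eqxx /= mxE scale0r.
  rewrite /adapted (negPf in1); case: i lin in1 => [|[|i]] lin in1; first lia.
    have -> : l = 0%N by lia.
    by rewrite /= !mxE inordK // mulr0 addr0 scale0r.
  rewrite chain_fst !mxE inordK; last lia.
  by have -> : (l == i.+2)%N = false; [lia | rewrite mulr0 scale0r].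
Qed.

Lemma adapted_presentation c k :
  (n.-1 <= c <= n)%N -> (k.*2 <= n.+1)%N ->
  ch n.-1 = (if (n <= c)%N then z else 0) ->
  (forall s, [lie B, ch s] = if (s + 4 == k.*2.+1)%N then z else 0) ->
  chain_presentation adapted n.+1 c k
    (fun j => if j == n.+1 then tau else j%:R - 2 + beta) d.
Proof.
move=> hc hk hend hpair.
have aX : adapted 0 = X by [].
have aY : adapted 1 = Y by rewrite /adapted ifF //; lia.
have az : adapted n.+1 = z by rewrite /adapted eqxx.
have zN q : q.1 \in N -> [lie z, q] = 0 by exact: ext_lie_central.
have aN j : (1 <= j)%N -> (adapted j).1 \in N.
  case: j => [|[|j]] // _; rewrite /adapted; case: ifP => _; rewrite ?mem0v //.
  exact: chain_nilradical.
split.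
- move=> j hj; rewrite aY; case: (eqVneq j n.+1) => [->|jn].
    by rewrite az zN // ifF //; lia.
  rewrite adapted_chain; last lia.
  rewrite -[LHS]/(ch j.-2.+1); case: (eqVneq j n) => [->|jn'].
    have -> : n.-2.+1 = n.-1 by lia.
    by rewrite hend az.
  rewrite adapted_chain ?ifT; [|lia..].
  by congr (ch _); lia.
- move=> j hj; rewrite aX; case: (eqVneq j n.+1) => [->|jn].
    by rewrite az lie_central_X.
  rewrite adapted_chain; last lia.
  rewrite chain_X; congr (_ *: _).
  by rewrite -[in RHS](subnK (proj1 (andP hj))) subn2 natrD; ring.
- by rewrite aX aY az HY.
- move=> i j hi hj; case: (eqVneq i n.+1) => [->|in1].
    by rewrite az zN ?aN ?ifF ?scale0r //; lia.
  case: (eqVneq j n.+1) => [->|jn1].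
    by rewrite lie_anti az zN ?aN ?ifF ?scale0r ?oppr0 //; lia.
  rewrite az !adapted_chain; [|lia..].
  rewrite (chain_pairing chain_pair_central) hpair.
  have -> : (i.-2 + j.-2 + 4 = i + j)%N by lia.
  case: ifP => _; last by rewrite scaler0 scale0r.
  by congr (_ *: _); case: i hi {in1} => [|[|i]] // _; rewrite !exprS; ring.
Qed.

End Adapted.

(** * Classification *)

Section Classification.
Variables (K : numFieldType) (n : nat) (beta : K) (V : vectType K).
Variable E : extension (s1_nilradical n beta) V.
Hypothesis n_ge3 : (3 <= n)%N.
Local Notation e i := (basis_vec K n i : lie_sort (s1 n beta)).
Local Notation N := (s1_nilradical n beta).
Local Notation M := (ext_lie E).
Local Notation psi := (ext_psi E).

Variable tau : K.
Hypothesis theta_e0 : forall v, ext_theta E (e 0%N) v = - (tau *: v).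

Local Notation X_ mu := ((e 0%N + mu *: e n, 0) : M).
Local Notation Y_ nu delta := ((e 1%N + nu *: e 2%N, delta) : M).
Local Notation B_ lam gam := ((lam *: e 2%N, gam) : M).

Lemma weight_of_chain : psi (e n) (e 1%N) != 0 -> tau = n%:R - 1 + beta.
Proof.
move=> nz; have -> : n%:R - 1 + beta = n%:R - 2 + beta + 1 :> K by ring.
apply: (psi_weight theta_e0 _ _ _ _ _ nz).
- by apply: e_nilradical; lia.
- exact: e_nilradical.
- by rewrite s1_br1 ?(basis_vec_over beta (ltnSn n)) //; lia.
- by apply: s1_br0; lia.
- by rewrite s1_br10 ?scale1r //; lia.
Qed.

Lemma weight_of_pairing : psi (e 2%N) (e n) != 0 -> tau = n%:R - 2 + 2 * beta.
Proof.
move=> nz; have -> : n%:R - 2 + 2 * beta = beta + (n%:R - 2 + beta) :> K by ring.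
apply: (psi_weight theta_e0 _ _ _ _ _ nz).
- exact: e_nilradical.
- by apply: e_nilradical; lia.
- by apply: s1_br_abel; lia.
- exact: s1_br20.
- by apply: s1_br0; lia.
Qed.

Hypothesis dimV : \dim {:V} = 1%N.

(** Since psi(e_1, e_n) is nonzero, mu removes the V-part of [Y, X] whatever tau is;
the V-part of [B, X] is removed by gam because tau - beta = n - 1 is nonzero. *)
Lemma normalise_chain lam : psi (e 2%N) (e n) = 0 -> psi (e n) (e 1%N) != 0 ->
  exists mu gam, forall z,
    [lie Y_ 0 0, X_ mu] = Y_ 0 0 + 0 *: z /\ [lie B_ lam gam, X_ mu] = beta *: B_ lam gam.
Proof.
move=> h2 h1; have tauE := weight_of_chain h1.
have h1' : psi (e 1%N) (e n) != 0 by rewrite ext_psi_anti oppr_eq0.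
have [r hr] := line_ratio dimV (psi (e 1%N) (e 0%N)) h1'.
have tb : tau - beta != 0.
  have -> : tau - beta = n.-1%:R by rewrite tauE -[n in LHS]prednK ?natr1; [ring|lia].
  by rewrite pnatr_eq0; lia.
exists (- r), (- (lam / (tau - beta)) *: psi (e 2%N) (X_ (- r)).1) => z; split.
  rewrite (lie_YX n_ge3 theta_e0) ?mul0r //= scaler0 addr0 scale0r addr0.
  by rewrite linearDr linearZr /= hr scaleNr subrr scale0r.
rewrite (lie_BX n_ge3 theta_e0).
set p := psi _ _; have -> : lam *: p + (tau - beta) *: (- (lam / (tau - beta)) *: p) = 0.
  by rewrite scalerA mulrN mulrC divfK // scaleNr subrr.
exact: addr0.
Qed.

(** The chain reaches V in its last step.  With index 2k-1 for the partner of e_2, if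
any, equality of the two values n - 1 + beta and 2 beta + 2k - 3 of tau yields the
weights of Ltilde. *)
Lemma extension_type_chain :
  psi (e 2%N) (e n) = 0 -> psi (e n) (e 1%N) != 0 ->
  lie_isomorphic M (s1 n.+1 beta) \/
  exists k : nat, exists hk : (2 <= k <= n./2)%N, lie_isomorphic M (Ltilde K hk).
Proof.
move=> h2 h1; have tauE := weight_of_chain h1.
have [/existsP[j nzj]|] := boolP [exists j : 'I_n.+1, (2 <= j)%N && (psi (e 2%N) (e j) != 0)].
- right; case/andP: nzj => j2 nzj.
  have jn : (j < n)%N.
    rewrite ltn_neqAle -ltnS ltn_ord andbT; apply: contraNneq nzj => ->.
    by rewrite h2.
  (* Rescaling B by lam multiplies the end of the chain by lam and the pairing by
     lam^2, so lam is the ratio of the two. *)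
  have [lam hlam] := line_ratio dimV (psi (e n) (e 1%N)) nzj.
  have lam0 : lam != 0 by apply: contraNneq h1 => l0; rewrite hlam l0 scale0r.
  have [mu [gam norm]] := normalise_chain lam h2 h1.
  pose zeta := lam *: psi (e n) (e 1%N).
  have zeta0 : zeta != 0 by rewrite scaler_eq0 negb_or lam0.
  have [HY HB] := norm (0, zeta).
  have supp := pairing_support n_ge3 theta_e0 HY HB _ lam0.
  have j2E : (j - 2).+2 = j by lia.
  have [oddj tauj] : odd (j - 2) /\ tau = 2 * beta + (j - 2)%:R by apply: supp; rewrite j2E.
  have [k kj] : exists k, j = k.*2.-1 :> nat by exists j./2.+1; lia.
  have hk : (2 <= k <= n./2)%N by lia.
  exists k, hk.
  apply: (iso_of_presentation (c := n) (k := k) (d := 0) _ _ (dim_ext E dimV)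
    (adapted_independent _ zeta0 lam0) (adapted_presentation n_ge3 theta_e0 HY HB _ _ _ _)).
  all: try lia.
  + by rewrite leqnn (chain_last _ n_ge3) /= scale0r addr0.
  + move=> s; rewrite -[B_ lam gam]/(chain (Y_ 0 0) (B_ lam gam) 0) chain_pair.
    case: ifP => hs.
      have -> : s.+2 = j by lia.
      by rewrite expr2 -scalerA -hlam.
    congr pair; apply/eqP; rewrite scaler_eq0; apply/orP; right.
    apply: contraFT hs => /supp[_]; rewrite tauj => /addrI/eqP.
    by rewrite eqr_nat; lia.
  + apply: eq_weight_presentation (presentation_Ltilde K hk) => i hi.
    have bE : beta = n%:R - 1 - (j - 2)%:R.
      have tt : n%:R - 1 + beta = 2 * beta + (j - 2)%:R by rewrite -tauE.
      apply: (addrI beta); transitivity (n%:R - 1 + beta - (j - 2)%:R); last by ring.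
      by rewrite tt; ring.
    have -> : k.*2 = (j - 2 + 3)%N by lia.
    by case: eqP => [->|_]; rewrite ?tauE bE natrD -?natr1; ring.
- rewrite negb_exists => /forallP none; left.
  have {}none s : psi (e 2%N) (e s.+2) = 0.
    have [sn|sn] := ltnP s.+2 n.+1; last by rewrite (basis_vec_over beta sn) linear0r.
    by have := none (Ordinal sn); rewrite /= negbK => /eqP.
  have [mu [gam norm]] := normalise_chain 1 h2 h1.
  have [HY HB] := norm (0, psi (e n) (e 1%N)).
  have lam0 : 1 != 0 :> K by exact: oner_neq0.
  apply: (iso_of_presentation (c := n) (k := 0) (d := 0) _ _ (dim_ext E dimV)
    (adapted_independent _ h1 lam0) (adapted_presentation n_ge3 theta_e0 HY HB _ _ _ _)).
  all: try lia.
  + by rewrite leqnn (chain_last _ n_ge3) /= scale0r addr0 scale1r.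
  + move=> s; rewrite -[B_ 1 gam]/(chain (Y_ 0 0) (B_ 1 gam) 0) chain_pair.
    by rewrite none scaler0 ifF //; lia.
  + apply: eq_weight_presentation (presentation_s1 _ _) => // i hi; case: eqP => // ->.
    by rewrite tauE -natr1; ring.
Qed.

(** Here mu is spent on [B, X], since psi(e_2, e_n) is nonzero while psi(e_n, Y)
vanishes by the choice of nu.  The V-part of [Y, X] is removed by delta if tau
differs from 1.  For tau = 1 delta has no effect on it; if it is not zero, lam is a
square root that makes it equal to the last basis vector, which scales with lam^2. *)
Lemma normalise_pairing : (forall t : K, exists r, r ^+ 2 = t) ->
  psi (e 2%N) (e n) != 0 ->
  exists mu nu lam delta d, let z : M := (0, lam ^+ 2 *: psi (e 2%N) (e n)) in
    [/\ lam != 0, psi (e n) (Y_ nu delta).1 = 0, d = 0 \/ d = 1 /\ tau = 1,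
        [lie Y_ nu delta, X_ mu] = Y_ nu delta + d *: z
      & [lie B_ lam 0, X_ mu] = beta *: B_ lam 0].
Proof.
move=> sqrts h2; set q := psi (e 2%N) (e n) in h2 *.
have [nu hnu] := line_ratio dimV (psi (e n) (e 1%N)) h2.
have [s hs] := line_ratio dimV (psi (e 2%N) (e 0%N)) h2.
have nub : nu * beta = nu.
  have [->|nu0] := eqVneq nu 0; first by rewrite mul0r.
  have h1 : psi (e n) (e 1%N) != 0 by rewrite hnu scaler_eq0 negb_or nu0.
  have tt : n%:R - 1 + beta = n%:R - 2 + 2 * beta.
    by rewrite -(weight_of_chain h1) (weight_of_pairing h2).
  have -> : beta = 1; last by rewrite mulr1.
  apply: (addrI (n%:R - 2 + beta)); transitivity (n%:R - 2 + 2 * beta); first by ring.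
  by rewrite -tt; ring.
pose p := psi (e 1%N + nu *: e 2%N) (X_ (- s)).1.
have nuq delta : psi (e n) (Y_ nu delta).1 = 0.
  by rewrite /= linearDr linearZr /= hnu (ext_psi_anti E (e n)) scalerN subrr.
have YX delta : [lie Y_ nu delta, X_ (- s)] = Y_ nu delta + (0, p + (tau - 1) *: delta).
  by rewrite (lie_YX n_ge3 theta_e0).
have BX lam : [lie B_ lam 0, X_ (- s)] = beta *: B_ lam 0.
  rewrite (lie_BX n_ge3 theta_e0) /= linearDr linearZr /= hs -/q scaleNr subrr.
  by rewrite !scaler0 addr0; exact: addr0.
have [t1|t1] := eqVneq tau 1; last first.
  exists (- s), nu, 1, (- (tau - 1)^-1 *: p), 0.
  split=> //; try exact: oner_neq0; first by left.
  rewrite YX scalerA mulrN divff ?subr_eq0 // scaleN1r subrr scale0r.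
  by [].
have [t ht] := line_ratio dimV p h2.
have [t0|t0] := eqVneq t 0.
  exists (- s), nu, 1, 0, 0; split=> //; try exact: oner_neq0; first by left.
  by rewrite YX ht t0 !scale0r scaler0 addr0.
have [r hr] := sqrts t.
exists (- s), nu, r, 0, 1; split=> //; first by rewrite -sqrf_eq0 hr.
  by right.
by rewrite YX hr ht scaler0 addr0 scale1r.
Qed.

(** The chain stops at index n, and V is reached by the pairing of e_2 with e_n.
With n + 1 = 2m, tau = 1 forces beta = 2 - m, the weights of tau2. *)
Lemma extension_type_pairing : (forall t : K, exists r, r ^+ 2 = t) ->
  psi (e 2%N) (e n) != 0 ->
  exists2 m : nat, n.+1 = m.*2 &
    lie_isomorphic M (tau1 m beta) \/ lie_isomorphic M (tau2 K m).
Proof.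
move=> sqrts h2; have tauE := weight_of_pairing h2.
have [mu [nu [lam [delta [d [lam0 hY dE HY HB]]]]]] := normalise_pairing sqrts h2.
set zeta := lam ^+ 2 *: _ in HY.
have zeta0 : zeta != 0 by rewrite scaler_eq0 negb_or sqrf_eq0 lam0.
have supp := pairing_support n_ge3 theta_e0 HY HB _ lam0.
have n2E : (n - 2).+2 = n by lia.
have [oddn taun] : odd (n - 2) /\ tau = 2 * beta + (n - 2)%:R by apply: supp; rewrite n2E.
have [m nm] : exists m, n.+1 = m.*2 by exists n.+1./2; lia.
exists m => //.
have indep := adapted_independent (E := E) n_ge3 (mu := mu) (nu := nu)
  (delta := delta) (gam := 0) zeta0 lam0.
have pres : chain_presentation (adapted E mu nu delta lam 0 zeta) n.+1 (m.*2 - 2) m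
    (fun j => if j == n.+1 then tau else j%:R - 2 + beta) d.
  apply: (adapted_presentation n_ge3 theta_e0 HY HB); try lia.
    by rewrite (chain_last _ n_ge3) hY scaler0 ifF //; lia.
  move=> s; rewrite -[B_ lam 0]/(chain (Y_ nu delta) (B_ lam 0) 0) chain_pair.
  case: ifP => hs.
    by have -> : s.+2 = n by lia.
  congr pair; apply/eqP; rewrite scaler_eq0; apply/orP; right.
  apply: contraFT hs => /supp[_]; rewrite taun => /addrI/eqP.
  by rewrite eqr_nat; lia.
have dimM := dim_ext E dimV.
rewrite nm in pres indep dimM.
have n_m : n%:R = m.*2%:R - 1 :> K by rewrite -nm -natr1 addrK.
case: dE => [d0|[d1 t1]].
- left; apply: (iso_of_presentation _ _ dimM indep pres); try lia.
  rewrite d0; apply: eq_weight_presentation (presentation_tau1 beta _) => [j hj|]; last lia.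
  by case: eqP => // _; rewrite tauE n_m; ring.
- right; apply: (iso_of_presentation _ _ dimM indep pres); try lia.
  rewrite d1; apply: eq_weight_presentation (presentation_tau2 K _) => [j hj|]; last lia.
  case: eqP => [_|_]; first by rewrite t1.
  have bE : beta = 2 - m%:R.
    apply: (mulfI (x := 2)); first by rewrite pnatr_eq0.
    by apply: (addrI (n%:R - 2)); rewrite -tauE t1 n_m -addnn natrD; ring.
  by rewrite bE; ring.
Qed.

End Classification.

Theorem theorem5p3 (R : realType) (n : nat) (beta : R[i]) (V : vectType R[i])
    (E : extension (s1_nilradical n beta) V) :
  (3 <= n)%N -> \dim {:V} = 1%N -> ext_nonsplit E ->
  [\/ lie_isomorphic (ext_lie E) (s1 n.+1 beta),
      exists2 m : nat, n.+1 = m.*2 & lie_isomorphic (ext_lie E) (tau1 m beta),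
      exists2 m : nat, n.+1 = m.*2 & lie_isomorphic (ext_lie E) (tau2 R[i] m)
    | exists k : nat, exists hk : (2 <= k <= n./2)%N,
        lie_isomorphic (ext_lie E) (Ltilde R[i] hk)].
Proof.
move=> n_ge3 dimV nonsplit.
have sqrts (t : R[i]) : exists r, r ^+ 2 = t by exists (sqrtC t); exact: sqrtCK.
have [t ht] := line_scalar dimV (ext_theta E (basis_vec _ n 0)).
have theta_e0 v : ext_theta E (basis_vec _ n 0) v = - (- t *: v) by rewrite ht scaleNr opprK.
have [h2|h2] := eqVneq (ext_psi E (basis_vec _ n 2) (basis_vec _ n n)) 0; last first.
  have [m nm [iso|iso]] := extension_type_pairing n_ge3 theta_e0 dimV sqrts h2.
    by apply: Or42; exists m.
  by apply: Or43; exists m.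
have [|h1] := nonsplit_witness n_ge3 nonsplit; first by rewrite h2 eqxx.
have [iso|iso] := extension_type_chain n_ge3 theta_e0 dimV h2 h1.
  exact: Or41.
exact: Or44.
Qed.
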